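(* Let $G=(V,E)$ be a graph and let ${\cal M}$ (source) and ${\cal M}'$ (target) be any two matchings of $G$. Then ${\cal M}$ can be gradually transformed into a matching containing ${\cal M}'$ (i.e., into ${\cal M}'$ or a superset of ${\cal M}'$) via a sequence of constant-time operations, grouped into phases of at most 3 operations each, such that the matching obtained at the end of each phase is a valid matching of $G$ of size at least $\min\{|{\cal M}|,|{\cal M}'|-1\}$. Moreover, the total running time of this transformation is $O(|{\cal M}|+|{\cal M}'|)$.
   Context: A gradual transformation maintains a current (transformed) set of edges ${\cal M}^*$, initialized to ${\cal M}$; an operation consists of a single edge insertion into or a single edge deletion from ${\cal M}^*$ and takes constant time. The transformation ends when the current set contains ${\cal M}'$. *)

(* Defs.v *)
From mathcomp Require Import all_boot.

Set Implicit Arguments.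
Unset Strict Implicit.
Unset Printing Implicit Defensive.

(* A finite simple graph is a finite vertex type V with a symmetric and
   irreflexive adjacency relation; edges are two-element sets of vertices. *)
Definition edges (V : finType) (adj : rel V) : {set {set V}} :=
  [set [set p.1; p.2] | p : V * V & adj p.1 p.2].

Definition is_matching (V : finType) (adj : rel V) (M : {set {set V}}) : bool :=
  (M \subset edges adj) && trivIset M.

(* T is the type of vertex names: V itself in the graph, nat on the machine. *)
Inductive op (T : Type) : Type :=
| Insert of T & T
| Delete of T & T.

Definition op_map (S T : Type) (f : S -> T) (o : op S) : op T :=
  match o with
  | Insert u v => Insert (f u) (f v)
  | Delete u v => Delete (f u) (f v)
  end.

Section Transformation.

Variables (V : finType) (adj : rel V).
Implicit Types (X M : {set {set V}}) (phases : seq (seq (op V))).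

Definition apply_op X (o : op V) : {set {set V}} :=
  match o with
  | Insert u v => [set u; v] |: X
  | Delete u v => X :\ [set u; v]
  end.

Definition legal_op X (o : op V) : bool :=
  match o with
  | Insert u v => adj u v && ([set u; v] \notin X)
  | Delete u v => [set u; v] \in X
  end.

Fixpoint legal_ops X (s : seq (op V)) : bool :=
  if s is o :: s' then legal_op X o && legal_ops (apply_op X o) s' else true.

Definition after M phases (i : nat) : {set {set V}} :=
  foldl apply_op M (flatten (take i phases)).

(* The current set starts as M, every operation inserts a new edge of the graph
   or deletes a current edge, and the transformation stops after the first
   phase (possibly none) at which the current set contains M'. *)
Definition gradual_transformation M M' phases : Prop :=
  [/\ legal_ops M (flatten phases),
      M' \subset after M phases (size phases)
    & forall i, i < size phases -> ~~ (M' \subset after M phases i)].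

(* An array representation of M: every edge once, in any order and with its
   endpoints in any order. *)
Definition edge_list M (L : seq (V * V)) : Prop :=
  size L = #|M| /\ M =i [seq [set p.1; p.2] | p <- L].

(* Memory contents given to the machine: the number of vertices, the lengths of
   the two lists, then the endpoints of the listed edges, a vertex being named
   by its rank in 0, ..., #|V| - 1. *)
Definition edge_words (L : seq (V * V)) : seq nat :=
  flatten [seq [:: (enum_rank p.1 : nat); (enum_rank p.2 : nat)] | p <- L].

Definition input (L L' : seq (V * V)) : seq nat :=
  [:: #|V|; size L; size L'] ++ edge_words L ++ edge_words L'.

Definition encode_phases phases : seq (seq (op nat)) :=
  map (map (op_map (fun v => enum_rank v : nat))) phases.

End Transformation.

(* Running time is measured on a random access machine with uniform cost,
   programmed by structured control flow: registers and memory cells hold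
   natural numbers, indirect addressing is through registers only, and the only
   arithmetic is addition and truncated subtraction. Operations on the current
   edge set are unit-time output instructions. *)
Inductive instr : Type :=
| IConst (x n : nat)      (* r_x := n *)
| IAdd (x y z : nat)      (* r_x := r_y + r_z *)
| ISub (x y z : nat)      (* r_x := r_y - r_z *)
| ILoad (x y : nat)       (* r_x := mem[r_y] *)
| IStore (x y : nat)      (* mem[r_x] := r_y *)
| IInsert (x y : nat)     (* insert the edge with endpoints r_x, r_y *)
| IDelete (x y : nat)     (* delete the edge with endpoints r_x, r_y *)
| IEndPhase.

Inductive program : Type :=
| Skip
| Do of instr
| Seq of program & program
| If (x : nat) of program & program   (* first branch when r_x <> 0 *)
| While (x : nat) of program.         (* loop as long as r_x <> 0 *)

Record state : Type := State {
  reg : nat -> nat;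
  mem : nat -> nat;
  closed_phases : seq (seq (op nat));
  open_phase : seq (op nat) }.

Definition step (i : instr) (s : state) : state :=
  let: State r m ph cur := s in
  match i with
  | IConst x n => State [eta r with x |-> n] m ph cur
  | IAdd x y z => State [eta r with x |-> r y + r z] m ph cur
  | ISub x y z => State [eta r with x |-> r y - r z] m ph cur
  | ILoad x y => State [eta r with x |-> m (r y)] m ph cur
  | IStore x y => State r [eta m with r x |-> r y] ph cur
  | IInsert x y => State r m ph (rcons cur (Insert (r x) (r y)))
  | IDelete x y => State r m ph (rcons cur (Delete (r x) (r y)))
  | IEndPhase => State r m (rcons ph cur) [::]
  end.

(* exec P s t s': started in s, P halts in s' after time t, every executed
   instruction (Skip included) and every evaluated test costing one unit. *)
Inductive exec : program -> state -> nat -> state -> Prop :=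
| ExecSkip s : exec Skip s 1 s
| ExecDo i s : exec (Do i) s 1 (step i s)
| ExecSeq P Q s t s' t' s'' :
    exec P s t s' -> exec Q s' t' s'' -> exec (Seq P Q) s (t + t') s''
| ExecIfT x P Q s t s' :
    reg s x != 0 -> exec P s t s' -> exec (If x P Q) s t.+1 s'
| ExecIfF x P Q s t s' :
    reg s x == 0 -> exec Q s t s' -> exec (If x P Q) s t.+1 s'
| ExecWhileT x P s t s' t' s'' :
    reg s x != 0 -> exec P s t s' -> exec (While x P) s' t' s'' ->
    exec (While x P) s (t + t').+1 s''
| ExecWhileF x P s : reg s x == 0 -> exec (While x P) s 1 s.

(* Registers and all memory beyond the input are initially zero. *)
Definition init_state (w : seq nat) : state :=
  State (fun _ => 0) (nth 0 w) [::] [::].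

(* On input w, P halts after time t, having output exactly these phases. *)
Definition outputs (P : program) (w : seq nat)
    (phases : seq (seq (op nat))) (t : nat) : Prop :=
  exists s, [/\ exec P (init_state w) t s, closed_phases s = phases
              & open_phase s = [::]].

(* Main.v *)
(* Repeatedly take an edge yz of M' missing from the current matching X, delete
   the X-edges at y and z, insert yz.  If y is free this does not shrink X; it
   may free the X-mate w of z, so the alternating path is followed from w.  Once
   every vertex covered by M' is covered by X, |M'| <= |X|, so a cycle (or a path
   with both end edges in M) may be broken by deleting one X-edge ux, leaving
   size at least |M'| - 1, after which following the paths freed at u and x never
   shrinks X again and covers all vertices of M' anew.  With mate tables in
   memory each phase takes constant time, paid for by the edge of M' that it
   inserts: the potential is |M' \ X|. *)
Require Import Defs.
From mathcomp Require Import all_boot zify.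

Set Implicit Arguments.
Unset Strict Implicit.
Unset Printing Implicit Defensive.

(** * Mates and matchings *)

Section Partner.

Variable V : finType.
Implicit Types (X Y : {set {set V}}) (A : {set V}) (u v w y z : V).

(** [pick] makes this total on arbitrary families of sets; the mate is unique only in a disjoint
    family, hence [trivIset] in [partnerE]. *)
Definition partner X u : option V := [pick v | [set u; v] \in X].

Lemma set2_inj u v w : [set u; v] = [set u; w] -> v = w.
Proof.
move=> eq_uvw; have: v \in [set u; w] by rewrite -eq_uvw set22.
rewrite in_set2 => /orP[/eqP vu|/eqP //].
have: w \in [set u; v] by rewrite eq_uvw set22.
by rewrite vu in_set2 orbb => /eqP.
Qed.

Lemma trivIset_eq X A (B : {set V}) u : trivIset X -> A \in X -> B \in X ->
  u \in A -> u \in B -> A = B.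
Proof.
move=> /trivIsetP tX AX BX uA uB; apply/eqP/negPn/negP=> neAB.
by have /pred0P/(_ u) := tX A B AX BX neAB; rewrite /= uA uB.
Qed.

Lemma partnerP X u v : partner X u = Some v -> [set u; v] \in X.
Proof. by rewrite /partner; case: pickP => // x xX [<-]. Qed.

Lemma partnerE X u v : trivIset X -> [set u; v] \in X -> partner X u = Some v.
Proof.
move=> tX uvX; rewrite /partner; case: pickP => [x uxX|/(_ v)]; last by rewrite uvX.
by congr Some; apply: (@set2_inj u); apply: (trivIset_eq tX uxX uvX (set21 u x) (set21 u v)).
Qed.

Lemma partnerNP X u v : partner X u = None -> [set u; v] \notin X.
Proof. by rewrite /partner; case: pickP => // /(_ v)/negbT. Qed.

Lemma partner_sym X u v : trivIset X -> partner X u = Some v -> partner X v = Some u.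
Proof. by move=> tX /partnerP uvX; apply: partnerE; rewrite // setUC. Qed.

Lemma partner0 u : partner set0 u = None.
Proof. by rewrite /partner; case: pickP => // v; rewrite inE. Qed.

Lemma partner_other X A u : u \notin A ->
  (partner (A |: X) u = partner X u) * (partner (X :\ A) u = partner X u).
Proof.
move=> uA; split; apply: eq_pick => v; rewrite !inE.
  by case: eqP => // eA; rewrite -eA set21 in uA.
by case: eqP => // eA; rewrite -eA set21 in uA.
Qed.

Lemma partner_del X u v : trivIset X -> [set u; v] \in X ->
  partner (X :\ [set u; v]) u = None.
Proof.
move=> tX uvX; rewrite /partner; case: pickP => // x; rewrite !inE => /andP[/eqP ne uxX].
by case: ne; apply: (trivIset_eq tX uxX uvX (set21 u x) (set21 u v)).
Qed.

End Partner.

Section Matchings.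

Variables (V : finType) (adj : rel V).
Hypotheses (adj_sym : symmetric adj) (adj_irr : irreflexive adj).
Implicit Types (X Y : {set {set V}}) (A : {set V}) (u v w y z : V).

Lemma edgesP A : reflect (exists u v, adj u v /\ A = [set u; v]) (A \in edges adj).
Proof.
apply: (iffP imsetP) => [[[u v] uv ->]|[u [v [uv ->]]]].
  by exists u, v; split=> //; move: uv; rewrite inE.
by exists (u, v); rewrite ?inE.
Qed.

Lemma edgeE u v : ([set u; v] \in edges adj) = adj u v.
Proof.
apply/edgesP/idP => [[a [b [ab eab]]]|uv]; last by exists u, v.
have /orP[/eqP ua|/eqP ub] : (u == a) || (u == b) by rewrite -in_set2 -eab set21.
  by subst u; rewrite (set2_inj eab).
by subst u; move: eab; rewrite [RHS]setUC => /set2_inj->; rewrite adj_sym.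
Qed.

Lemma adj_neq u v : adj u v -> u != v.
Proof. by apply: contraTneq => ->; rewrite adj_irr. Qed.

Lemma matching_sub X Y : X \subset Y -> is_matching adj Y -> is_matching adj X.
Proof.
by move=> XY /andP[Ye Yt]; rewrite /is_matching (subset_trans XY) ?(trivIsetS XY).
Qed.

Lemma matching_adj X u v : is_matching adj X -> [set u; v] \in X -> adj u v.
Proof. by case/andP=> /subsetP Xe _ /Xe; rewrite edgeE. Qed.

(** Any edge of [X] meeting [[set u; v]] would give [u] or [v] a mate, so the new edge is disjoint
    from all of [X]. *)
Lemma matching_add X u v : is_matching adj X -> adj u v ->
  partner X u = None -> partner X v = None -> is_matching adj ([set u; v] |: X).
Proof.
move=> /andP[Xe Xt] uv pu pv; rewrite /is_matching subUset sub1set edgeE uv Xe /=.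
have free x : x \in [set u; v] -> partner X x = None.
  by rewrite in_set2 => /orP[]/eqP->.
have disj C : C \in X -> [disjoint [set u; v] & C].
  move=> CX; apply/pred0P=> x /=; apply/negP=> /andP[/free px xC].
  have /edgesP[a [b [_ eC]]] := subsetP Xe _ CX; subst C.
  move: xC; rewrite in_set2 => /orP[]/eqP ex; subst x.
    by have := partnerNP b px; rewrite CX.
  by have := partnerNP a px; rewrite setUC CX.
apply/trivIsetP=> A B; rewrite !in_setU1 => /orP[/eqP->|AX] /orP[/eqP->|BX].
- by rewrite eqxx.
- by move=> _; apply: disj.
- by move=> _; rewrite disjoint_sym; apply: disj.
- exact: (trivIsetP Xt).
Qed.

Definition covered X : {set V} := [set u | partner X u != None].

(** [covered X] is the union of the disjoint edges of [X], and irreflexivity gives each of them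
    exactly two vertices. *)
Lemma card_covered X : is_matching adj X -> #|covered X| = #|X| * 2.
Proof.
move=> mX; have /andP[Xe Xt] := mX.
have -> : covered X = cover X.
  apply/setP=> u; rewrite inE; apply/idP/bigcupP => [|[A AX uA]].
    by case Ep: (partner X u) => [v|] // _; exists [set u; v]; rewrite ?set21 ?partnerP.
  have /edgesP[a [b [_ eA]]] := subsetP Xe _ AX; subst A.
  move: uA; rewrite in_set2 => /orP[]/eqP->; first by rewrite (partnerE Xt AX).
  by rewrite (partnerE (v := a) Xt) // setUC.
move: Xt; rewrite /trivIset => /eqP <-; rewrite -sum_nat_const; apply: eq_bigr => A AX.
by have /edgesP[a [b [/adj_neq ab ->]]] := subsetP Xe _ AX; rewrite cards2 ab.
Qed.

Lemma card_matching_le X Y : is_matching adj X -> is_matching adj Y ->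
  covered X \subset covered Y -> #|X| <= #|Y|.
Proof.
by move=> mX mY /subset_leq_card; rewrite !card_covered // leq_pmul2r.
Qed.

(** * Phases of operations and the moves that preserve their invariant *)

Section Phases.

Variables M M' : {set {set V}}.
Hypotheses (matchM : is_matching adj M) (matchM' : is_matching adj M').
Implicit Types (phs : seq (seq (op V))) (cur ops : seq (op V)).

Definition bound := minn #|M| (#|M'| - 1).

Definition valid_phases phs :=
  all (fun ph => size ph <= 3) phs /\
  forall i, i < size phs ->
    [/\ ~~ (M' \subset after M phs i), is_matching adj (after M phs i.+1)
      & bound <= #|after M phs i.+1|].

(* [cur] is the phase under construction.  It may already hold the deletion of
   one edge outside M', so that the first phase started on an alternating cycle
   has the same shape as all others. *)
Record progress phs cur X : Prop := Progress {
  prog_valid : valid_phases phs;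
  prog_legal : legal_ops adj M (flatten phs ++ cur);
  prog_current : X = foldl (@apply_op V) M (flatten phs ++ cur);
  prog_open : size cur <= 1;
  prog_kept : M' :&: after M phs (size phs) \subset X;
  prog_match : is_matching adj X;
  prog_bound : bound <= #|X| }.

Lemma legal_ops_cat X s1 s2 : legal_ops adj X (s1 ++ s2) =
  legal_ops adj X s1 && legal_ops adj (foldl (@apply_op V) X s1) s2.
Proof. by elim: s1 X => //= o s IH X; rewrite IH andbA. Qed.

Lemma after_size phs : after M phs (size phs) = foldl (@apply_op V) M (flatten phs).
Proof. by rewrite /after take_size. Qed.

Lemma after_rcons phs ph i : i <= size phs -> after M (rcons phs ph) i = after M phs i.
Proof. by move=> le_i; rewrite /after -cats1 takel_cat. Qed.

Lemma progress_start : progress [::] [::] M.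
Proof. by split; rewrite //= ?take0 ?subsetIr ?geq_minl. Qed.

(** One open deletion and at most two further operations respect the limit of three. By [prog_kept],
    if [M'] were contained in the set after the last closed phase, it would be contained in [X]; so
    the transformation had not yet stopped there. *)
Lemma progress_close phs cur X ops X' : progress phs cur X ->
    legal_ops adj X ops -> size ops <= 2 -> X' = foldl (@apply_op V) X ops ->
    is_matching adj X' -> bound <= #|X'| -> ~~ (M' \subset X) ->
  progress (rcons phs (cur ++ ops)) [::] X'.
Proof.
move=> [[le3 val] leg curE le1 kept mX bX] leg' le2 X'E mX' bX' nsub.
have flatE : flatten (rcons phs (cur ++ ops)) = (flatten phs ++ cur) ++ ops.
  by rewrite -cats1 flatten_cat /= cats0 catA.
have X'M : foldl (@apply_op V) M (flatten (rcons phs (cur ++ ops))) = X'.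
  by rewrite flatE foldl_cat -curE.
split=> //; rewrite ?cats0 //; last first.
- by rewrite after_size X'M subsetIr.
- by rewrite flatE legal_ops_cat leg -curE.
split; first by rewrite all_rcons le3 andbT size_cat (leq_add le1 le2).
move=> i; rewrite size_rcons ltnS leq_eqVlt => /orP[/eqP->|lt_i]; last first.
  by rewrite (after_rcons _ lt_i) (after_rcons _ (ltnW lt_i)); apply: val.
rewrite after_rcons // -(size_rcons phs (cur ++ ops)) [after M _ (size (rcons _ _))]after_size.
rewrite X'M; split=> //.
apply: contra nsub => sub; apply: subset_trans kept.
by rewrite subsetI subxx.
Qed.

(** Makes room at [z] for an edge [yz] whose other end [y] is free. *)
Definition eviction X z : seq (op V) :=
  if partner X z is Some w then [:: Delete z w] else [::].

(** The gaps that the walks fill. Once there are none, counting covered vertices gives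
    [#|M'| <= #|X|], the slack that permits breaking a cycle. *)
Definition exposed X : {set V} := covered M' :\: covered X.

Definition optset (o : option V) : {set V} := if o is Some w then [set w] else set0.

(** Trading [zw] for [yz] keeps the size, and the size grows if [z] was free. The vertex [y] stops
    being exposed, and only the evicted mate [w] can become so. The potential falls because [yz] is
    gained and no edge of [M'] is lost. *)
Lemma progress_step phs cur X y z :
    progress phs cur X -> partner X y = None -> partner M' y = Some z ->
  let X' := [set y; z] |: foldl (@apply_op V) X (eviction X z) in
  [/\ progress (rcons phs (cur ++ rcons (eviction X z) (Insert y z))) [::] X',
      exposed X' \subset (exposed X :\ y) :|: optset (partner X z),
      M' :&: X \subset X',
      [set y; z] \in X'
    & #|M' :\: X'| < #|M' :\: X|].
Proof.
move=> pr py pz X'.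
have [/andP[Xe Xt] /andP[M'e M't]] := (prog_match pr, matchM').
have yzM' := partnerP pz.
have yz : adj y z by apply: matching_adj yzM'.
have yNz := adj_neq yz.
set X1 := foldl (@apply_op V) X (eviction X z).
have X1E : X1 = if partner X z is Some w then X :\ [set z; w] else X.
  by rewrite /X1 /eviction; case: (partner X z).
have yNw w : partner X z = Some w -> y != w.
  by apply: contra_eqN => /eqP <-; apply/eqP=> /(partner_sym Xt); rewrite py.
have X1X : X1 \subset X by rewrite X1E; case: (partner X z) => // w; rewrite subD1set.
have mX1 : is_matching adj X1 by apply: matching_sub X1X (prog_match pr).
have py1 : partner X1 y = None.
  rewrite X1E; case pzX: (partner X z) => [w|] //.
  by rewrite partner_other // in_set2 negb_or yNz yNw.
have pz1 : partner X1 z = None.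
  rewrite X1E; case pzX: (partner X z) => [w|] //.
  by rewrite partner_del // partnerP.
have yzX : [set y; z] \notin X := partnerNP z py.
have yzX1 : [set y; z] \notin X1 := partnerNP z py1.
have mX' : is_matching adj X' := matching_add mX1 yz py1 pz1.
have /andP[_ X't] := mX'.
have sub : M' :&: X \subset X'.
  apply/subsetP=> A; rewrite inE => /andP[AM' AX].
  rewrite in_setU1 -/X1 X1E; case pzX: (partner X z) => [w|]; last by rewrite AX orbT.
  (* [M'] matches [z] to [y], which differs from [w], so the evicted edge is outside [M']. *)
  rewrite in_setD1 AX andbT; apply/orP; right; apply: contraTneq AM' => ->.
  apply/negP=> zwM'; have := partnerE M't zwM'; rewrite (partner_sym M't pz) => -[yw].
  by have := yNw w pzX; rewrite yw eqxx.
split=> //.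
- apply: (progress_close pr); rewrite // -?cats1 ?foldl_cat //.
  + rewrite legal_ops_cat -/X1 /= yz yzX1 /= andbT /eviction.
    by case pzX: (partner X z) => [w|] //=; rewrite partnerP.
  + by rewrite /eviction size_cat; case: (partner X z).
  + apply: leq_trans (prog_bound pr) _; rewrite cardsU1 -/X1 yzX1 X1E.
    case pzX: (partner X z) => [w|]; last by rewrite leq_addl.
    by rewrite (cardsD1 [set z; w] X) partnerP.
  (* Since [y] is free, [X] lacks the edge [yz] of [M']. *)
  + by apply: contra yzX => /subsetP; apply.
- apply/subsetP=> v; rewrite !inE negbK => /andP[/eqP pv ->]; rewrite andbT.
  have vNyz : v \notin [set y; z].
    rewrite in_set2; apply/negP=> /orP[]/eqP ev; subst v.
      by have := partnerNP z pv; rewrite setU11.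
    by have := partnerNP y pv; rewrite [[set z; y]]setUC setU11.
  move: (vNyz); rewrite in_set2 negb_or => /andP[-> vNz] /=.
  move: pv; rewrite partner_other // -/X1 X1E.
  case pzX: (partner X z) => [w|]; last by move->.
  have [-> _|vNw] := eqVneq v w; first by rewrite set11 orbT.
  by rewrite partner_other ?in_set2 ?negb_or ?vNz // => ->.
- by rewrite setU11.
- apply: proper_card; apply/properP; split.
    apply/subsetP=> A; rewrite !inE => /andP[AX' AM']; rewrite AM' andbT.
    by apply: contra AX' => AX; rewrite -in_setU1 (subsetP sub) // inE AM'.
  by exists [set y; z]; rewrite !inE ?eqxx ?yzM' ?yzX ?orbT.
Qed.

(* If M' only covers vertices covered by X, then |M'| <= |X|: an edge can be
   removed from X within the size bound. *)
Lemma progress_break phs X u x : progress phs [::] X -> exposed X = set0 ->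
    partner X u = Some x -> [set u; x] \notin M' ->
  [/\ progress phs [:: Delete u x] (X :\ [set u; x]),
      exposed (X :\ [set u; x]) \subset [set u; x],
      partner (X :\ [set u; x]) u = None &
      M' :&: X \subset X :\ [set u; x]].
Proof.
move=> [val leg curE _ kept mX bX] exp0 pu uxM'.
have /andP[_ Xt] := mX; have uxX := partnerP pu.
have subX : M' :&: X \subset X :\ [set u; x].
  apply/subsetP=> A; rewrite !inE => /andP[AM' ->]; rewrite andbT.
  by apply: contraTneq AM' => ->.
rewrite cats0 in curE; rewrite cats0 in leg.
split=> //; last 1 first.
- exact: partner_del.
- split=> //.
  + by rewrite legal_ops_cat leg -curE /= uxX.
  + by rewrite foldl_cat -curE.
  + by rewrite after_size -curE.
  + exact: matching_sub (subD1set _ _) mX.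
  + have: #|M'| <= #|X| by apply: card_matching_le; rewrite // -setD_eq0 -/(exposed X) exp0.
    rewrite (cardsD1 [set u; x] X) uxX add1n /bound => leM'.
    by apply: leq_trans (geq_minr _ _) _; rewrite leq_subLR.
- apply/subsetP=> v; rewrite !inE negbK => /andP[/eqP pv pv']; rewrite -in_set2.
  apply: contraT => vux; move: pv; rewrite partner_other // => pv.
  by move/setP/(_ v): exp0; rewrite !inE pv eqxx pv'.
Qed.

End Phases.

End Matchings.
(** * Time-credit weakest preconditions *)

(* [mem] alone is the membership predicate. *)
Local Notation cells := Defs.mem.

Section TimedPrograms.

(* [k] is a time credit: the run from [s] costs at most [k], and [Q] receives
   what is left of it. *)
Definition wp (P : program) (Q : state -> nat -> Prop) (s : state) (k : nat) :=
  exists t s', [/\ exec P s t s', t <= k & Q s' (k - t)].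

Lemma wp_conseq P (Q Q' : state -> nat -> Prop) s k :
  (forall s' k', Q s' k' -> Q' s' k') -> wp P Q s k -> wp P Q' s k.
Proof. by move=> QQ' [t [s' [ex le_t /QQ' q]]]; exists t, s'. Qed.

Lemma wp_seq P P' Q s k : wp P (wp P' Q) s k -> wp (Seq P P') Q s k.
Proof.
move=> [t [s' [ex le_t [t' [s'' [ex' le_t' q]]]]]]; exists (t + t'), s''.
split; [exact: ExecSeq ex ex'|lia|by rewrite subnDA].
Qed.

Lemma wp_if x P P' Q s k : 0 < k ->
  wp (if reg s x != 0 then P else P') Q s k.-1 -> wp (If x P P') Q s k.
Proof.
move=> k_gt0 [t [s' [ex le_t q]]]; exists t.+1, s'.
have -> : k - t.+1 = k.-1 - t by lia.
split=> //; last by lia.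
by case: ifP ex => [nz|/negbFE z]; [apply: ExecIfT|apply: ExecIfF].
Qed.

Lemma wp_while_true x P Q s k : 0 < k -> reg s x != 0 ->
  wp P (wp (While x P) Q) s k.-1 -> wp (While x P) Q s k.
Proof.
move=> k_gt0 nz [t [s' [ex le_t [t' [s'' [ex' le_t' q]]]]]]; exists (t + t').+1, s''.
have -> : k - (t + t').+1 = k.-1 - t - t' by lia.
by split; [exact: ExecWhileT ex ex'|lia|].
Qed.

Lemma wp_while_false x P (Q : state -> nat -> Prop) s k : 0 < k -> reg s x = 0 ->
  Q s k.-1 -> wp (While x P) Q s k.
Proof.
move=> k_gt0 z q; exists 1, s; rewrite subn1.
by split=> //; apply: ExecWhileF; rewrite z.
Qed.

Lemma wp_skip (Q : state -> nat -> Prop) s k : 0 < k -> Q s k.-1 -> wp Skip Q s k.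
Proof. by move=> k_gt0 q; exists 1, s; rewrite subn1; split=> //; apply: ExecSkip. Qed.

(** The closing [Skip] costs one unit, so a block takes its length plus one. *)
Definition block (l : seq instr) : program := foldr (fun i P => Seq (Do i) P) Skip l.

Definition steps (l : seq instr) (s : state) : state := foldl (fun s i => step i s) s l.

Lemma wp_block l (Q : state -> nat -> Prop) s k : size l < k ->
  Q (steps l s) (k - (size l).+1) -> wp (block l) Q s k.
Proof.
elim: l s k => [|i l IH] s k /= lt_k q; first by apply: wp_skip => //; rewrite -subn1.
apply: wp_seq; exists 1, (step i s); split; [exact: ExecDo|lia|].
by apply: IH; [lia|rewrite -subnDA add1n].
Qed.

End TimedPrograms.

Arguments block l : simpl never.

(** * The program *)

Local Notation rOne := 0 (only parsing).
Local Notation rN := 1 (only parsing).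
Local Notation rBase := 2 (only parsing).
Local Notation rPos := 3 (only parsing).
Local Notation rEnd := 4 (only parsing).
Local Notation rOff := 5 (only parsing).
Local Notation rZero := 6 (only parsing).
Local Notation rU := 7 (only parsing).
Local Notation rV := 8 (only parsing).
Local Notation rX := 9 (only parsing).
Local Notation rLoop := 10 (only parsing).
Local Notation rY := 11 (only parsing).
Local Notation rZ := 12 (only parsing).
Local Notation rW := 13 (only parsing).
Local Notation rTest := 14 (only parsing).
Local Notation rA := 15 (only parsing).
Local Notation rB := 16 (only parsing).

(** The truncated difference [rEnd - rPos] serves as loop test; [rOff] turns the ranks read from the
    input into cell addresses of a table. *)
Definition for_edges (body : program) : program :=
  Seq (block [:: ISub rLoop rEnd rPos])
    (While rLoop
      (Seq (block [:: ILoad rU rPos; IAdd rU rU rOff; IAdd rPos rPos rOne;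
                      ILoad rV rPos; IAdd rV rV rOff; IAdd rPos rPos rOne])
        (Seq body (block [:: ISub rLoop rEnd rPos])))).

(* Cell [B + rank u] holds [B + rank v] if [u] is currently matched to [v], and
   0 if [u] is free, where [B] is the length of the input; the same table for
   M' starts at [B + n].  The null pointer never passes the test: cell 0 holds
   [n], which is positive. *)
Definition walk_test : program :=
  block [:: ILoad rW rY; IAdd rZ rY rN; ILoad rZ rZ;
            ISub rTest rOne rZ; IAdd rTest rTest rW; ISub rTest rOne rTest].

(** On deletion only the cell of [w] is cleared, since that of [z] is overwritten by the insertion.
    The pointer to [w], null if [z] was free, becomes the next [y]. *)
Definition walk_step : program :=
  Seq (block [:: ISub rZ rZ rN; ILoad rW rZ])
    (Seq (If rW (block [:: ISub rA rZ rBase; ISub rB rW rBase; IDelete rA rB;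
                           IStore rW rZero]) Skip)
      (block [:: ISub rA rY rBase; ISub rB rZ rBase; IInsert rA rB; IEndPhase;
                 IStore rY rZ; IStore rZ rY; IAdd rY rW rZero])).

Definition walk : program := Seq walk_test (While rTest (Seq walk_step walk_test)).

Definition store_edge : program := block [:: IStore rU rV; IStore rV rU].

Definition fill_gaps : program :=
  Seq (block [:: IAdd rY rU rZero]) (Seq walk (Seq (block [:: IAdd rY rV rZero]) walk)).

(** The two truncated differences sum to zero exactly when the current mate of [u] is [v]. No
    [IEndPhase] follows the deletion: it joins the first phase of the walk from [u], whence phases
    of three operations. *)
Definition break_cycle : program :=
  Seq (block [:: ILoad rX rU; ISub rTest rX rV; ISub rA rV rX; IAdd rTest rTest rA])
    (If rTest
      (Seq (block [:: ISub rA rU rBase; ISub rB rX rBase; IDelete rA rB;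
                      IStore rU rZero; IStore rX rZero; IAdd rY rU rZero])
        (Seq walk (Seq (block [:: IAdd rY rX rZero]) walk)))
      Skip).

(** Leaves [rPos] and [rEnd] at the bounds of the source list, and [rBase] and [rOff] at the input
    length, the first free cell. *)
Definition setup : seq instr :=
  [:: IConst rOne 1; ILoad rN rZero; ILoad rEnd rOne; IAdd rEnd rEnd rEnd;
      IConst rPos 3; IAdd rEnd rEnd rPos; IAdd rOff rOne rOne; ILoad rBase rOff;
      IAdd rBase rBase rBase; IAdd rBase rEnd rBase; IAdd rOff rBase rZero].

(** The argument [rN] aims at the table of [M'], and [rZero] at the table of the current set. *)
Definition target_edges (r : nat) : seq instr :=
  [:: ILoad rPos rOne; IAdd rPos rPos rPos; IConst rOff 3; IAdd rPos rPos rOff;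
      IAdd rEnd rBase rZero; IAdd rOff rBase r].

Definition transform : program :=
  Seq (block setup) (Seq (for_edges store_edge)
  (Seq (block (target_edges rN)) (Seq (for_edges store_edge)
  (Seq (block (target_edges rZero)) (Seq (for_edges fill_gaps)
  (Seq (block (target_edges rZero)) (for_edges break_cycle))))))).

(** * Mate tables in memory *)

Section Tables.

Variable V : finType.
Implicit Types (X : {set {set V}}) (u v w y z : V) (m : nat -> nat) (b : nat).

Local Notation rank v := (enum_rank v : nat).

(** Zero can serve as null because the tables are placed after the input, at a positive address. *)
Definition pointer b (o : option V) : nat := if o is Some v then b + rank v else 0.

Definition table m b X : Prop := forall u, m (b + rank u) = pointer b (partner X u).

Lemma rank_eq u v : (rank u == rank v) = (u == v).
Proof. by rewrite -(inj_eq enum_rank_inj). Qed.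

Lemma table_other m m' b X :
  (forall a, b <= a < b + #|V| -> m' a = m a) -> table m b X -> table m' b X.
Proof.
by move=> mm' tm u; rewrite mm' // leq_addr ltn_add2l ltn_ord.
Qed.

Lemma table_add m b X u v : table m b X -> trivIset ([set u; v] |: X) ->
  table [eta [eta m with b + rank u |-> b + rank v] with b + rank v |-> b + rank u]
    b ([set u; v] |: X).
Proof.
move=> tm tX x; rewrite /= !eqn_add2l !rank_eq.
have [->|xNv] := eqVneq x v; first by rewrite (partnerE (v := u) tX) // setUC setU11.
have [->|xNu] := eqVneq x u; first by rewrite (partnerE (v := v) tX) // setU11.
by rewrite tm partner_other // in_set2 negb_or xNu.
Qed.

Lemma table_del m b X u v : table m b X -> trivIset X -> [set u; v] \in X ->
  table [eta [eta m with b + rank u |-> 0] with b + rank v |-> 0] b (X :\ [set u; v]).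
Proof.
move=> tm tX uvX x; rewrite /= !eqn_add2l !rank_eq.
have [->|xNv] := eqVneq x v; first by rewrite setUC partner_del // setUC.
have [->|xNu] := eqVneq x u; first by rewrite partner_del.
by rewrite tm partner_other // in_set2 negb_or xNu.
Qed.

Lemma table_move m b X y z : table m b X -> trivIset X ->
    trivIset ([set y; z] |: foldl (@apply_op V) X (eviction X z)) ->
  let m1 : nat -> nat := if partner X z is Some w then [eta m with b + rank w |-> 0] else m in
  table [eta [eta m1 with b + rank y |-> b + rank z] with b + rank z |-> b + rank y]
    b ([set y; z] |: foldl (@apply_op V) X (eviction X z)).
Proof.
move=> tm tX; rewrite /eviction; case Ew: (partner X z) => [w|] tX' /=; last first.
  exact: table_add.
move=> x; rewrite /= !eqn_add2l !rank_eq.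
have zwX := partnerP Ew.
have [->|xNz] := eqVneq x z; first by rewrite (partnerE (v := y) tX') // setUC setU11.
have [->|xNy] := eqVneq x y; first by rewrite (partnerE (v := z) tX') // setU11.
rewrite partner_other; last by rewrite in_set2 negb_or xNy.
have [->|xNw] := eqVneq x w; first by rewrite setUC partner_del // setUC.
by rewrite tm partner_other // in_set2 negb_or xNz.
Qed.

Lemma size_edge_words (ls : seq (V * V)) : size (edge_words ls) = size ls * 2.
Proof. by elim: ls => //= e ls ->; rewrite mulSn. Qed.

End Tables.

(** * Correctness of the program *)

Section Run.

Variables (V : finType) (adj : rel V).
Hypotheses (adj_sym : symmetric adj) (adj_irr : irreflexive adj).
Variables (M M' : {set {set V}}) (L L' : seq (V * V)).
Hypotheses (matchM : is_matching adj M) (matchM' : is_matching adj M').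
Hypotheses (listL : edge_list M L) (listL' : edge_list M' L').
Implicit Types (X Y : {set {set V}}) (u v w y z : V) (m : nat -> nat).

Local Notation rank v := (enum_rank v : nat).
(* Opaque names, lest simplification unfold the input. *)
Variables (inp : seq nat) (B : nat).
Hypotheses (inpE : inp = input L L') (BE : B = size inp).
Local Notation n := #|V|.
Local Notation rename := (map (op_map (fun v : V => rank v))).

Lemma size_input : B = 3 + size L * 2 + size L' * 2.
Proof. by rewrite BE inpE /input !size_cat !size_edge_words. Qed.

Definition input_kept m : Prop := forall i, i < B -> m i = nth 0 inp i.

Definition consts (r : nat -> nat) : Prop :=
  [/\ r rOne = 1, r rN = n, r rBase = B & r rZero = 0].

(** Used with 7, which protects the constants and the loop bounds, and with 11, which also protects
    [rU], [rV] and [rX]. *)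
Definition same_regs k (s s' : state) : Prop := forall i, i < k -> reg s' i = reg s i.

Lemma consts_same k s s' : 6 < k -> same_regs k s s' -> consts (reg s) -> consts (reg s').
Proof.
by move=> lt_k ss' [c0 c1 c2 c6]; split; rewrite ss' //; apply: leq_trans lt_k.
Qed.

Definition aimed (s : state) (b : nat) (ls : seq (V * V)) : Prop :=
  [/\ reg s rEnd = reg s rPos + size ls * 2, reg s rEnd <= B, reg s rOff = b &
    forall j, j < size ls * 2 -> nth 0 inp (reg s rPos + j) = nth 0 (edge_words ls) j].

(** The invariant [J] speaks of the edges still to be read, the memory, the output and the credit.
    An iteration pays 8 units for the loop test and the block that reads an edge, and 2 for
    recomputing the loop counter. *)
Lemma wp_for_edges (body : program) (b : nat)
    (J : seq (V * V) -> (nat -> nat) -> seq (seq (op nat)) -> seq (op nat) -> nat -> Prop)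
    (Q : state -> nat -> Prop) (ls : seq (V * V)) (s : state) (k : nat) :
    (forall ls' m ph cur k', J ls' m ph cur k' -> input_kept m) ->
    (forall e ls' s1 k1, consts (reg s1) ->
       J (e :: ls') (cells s1) (closed_phases s1) (open_phase s1) k1 ->
       reg s1 rU = b + rank e.1 -> reg s1 rV = b + rank e.2 ->
       8 <= k1 /\
       wp body (fun s' k' => [/\ same_regs 7 s1 s', 2 <= k' &
         J ls' (cells s') (closed_phases s') (open_phase s') (k' - 2)]) s1 (k1 - 8)) ->
    consts (reg s) -> aimed s b ls -> 2 <= k -> J ls (cells s) (closed_phases s) (open_phase s) (k - 2) ->
    (forall s' k', consts (reg s') ->
       J [::] (cells s') (closed_phases s') (open_phase s') k' -> 0 < k' /\ Q s' k'.-1) ->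
  wp (for_edges body) Q s k.
Proof.
move=> J_kept body_ok cs aim k_ge2 js Q_ok; rewrite /for_edges; apply: wp_seq.
elim: ls s k cs aim k_ge2 js => [|e ls IH] [r m ph cur] k
  [/= c0 c1 c2 c6] [/= eE le_B bE rd] k_ge2 js; apply: wp_block => //.
  set s' := steps _ _; have [k'_gt0 Qs'] := Q_ok s' _ (And4 c0 c1 c2 c6) js.
  by apply: wp_while_false => //=; rewrite eE mul0n addn0 subnn.
rewrite eE in le_B; move pE: (r rPos) eE le_B rd => p eE le_B rd.
set s1 := steps _ _; have kept := J_kept _ _ _ _ _ js.
have rd0 : nth 0 inp p = rank e.1 by rewrite -[p]addn0 rd.
have rd1 : nth 0 inp p.+1 = rank e.2 by rewrite -[p.+1]addn1 rd.
have [le0 le1] : p < B /\ p.+1 < B by split; apply: leq_trans le_B => /=; lia.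
set k1 := k - _ in js *.
(* An artificial state with the edge already loaded shows in advance that the credit covers the test
   and the loading. *)
have [k1_ge8 _] := body_ok e ls (State [eta [eta r with rU |-> b + rank e.1]
   with rV |-> b + rank e.2] m ph cur) k1 (And4 c0 c1 c2 c6) js erefl erefl.
apply: wp_while_true => /=; first by lia.
  by rewrite pE eE /=; lia.
apply: wp_seq; apply: wp_block; first by rewrite /=; lia.
set s2 := steps _ _.
have cs2 : consts (reg s2) by split.
have [] := body_ok e ls s2 k1 cs2 js.
- by rewrite /s2 /s1 /= pE bE kept // rd0 addnC.
- by rewrite /s2 /s1 /= pE c0 bE addn1 kept // rd1 addnC.
move=> _; have -> : k1 - 8 = k1.-1 - (size [:: ILoad rU rPos; IAdd rU rU rOff;
  IAdd rPos rPos rOne; ILoad rV rPos; IAdd rV rV rOff; IAdd rPos rPos rOne]).+1.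
  by rewrite /=; lia.
move=> run; apply: wp_seq; apply: wp_conseq run => s3 k3 [s23 k3_ge2 js3].
have r3 i : i < 7 -> reg s3 i = reg s2 i by apply: s23.
apply: (IH s3 k3) => //; first exact: consts_same s23 cs2.
rewrite /aimed !r3 //= pE c0 !addn1; split=> //; first by rewrite eE /= mulSn; lia.
- by rewrite eE.
- by move=> j lt_j; have := rd j.+2; rewrite !addnS !addSn; apply.
Qed.

(** * Simulation of the abstract moves along an alternating walk *)

Definition tables m X Y : Prop :=
  [/\ input_kept m, table m B X & table m (B + n) Y].

Record sim (s : state) X (phs : seq (seq (op V))) (cur : seq (op V)) : Prop := Sim {
  sim_consts : consts (reg s);
  sim_tables : tables (cells s) X M';
  sim_closed : closed_phases s = encode_phases phs;
  sim_open : open_phase s = rename cur;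
  sim_progress : progress adj M M' phs cur X }.

Lemma size_input_gt0 : 0 < B.
Proof. by rewrite size_input. Qed.

Lemma input_kept_set m a x : B <= a -> input_kept m -> input_kept [eta m with a |-> x].
Proof.
move=> le_a km i lt_i /=; rewrite ifN ?km // neq_ltn (leq_trans lt_i) //.
Qed.

Lemma table_shift m a x X : a < B + n -> table m (B + n) X ->
  table [eta m with a |-> x] (B + n) X.
Proof.
move=> lt_a; apply: table_other => i /andP[le_i _] /=.
by rewrite ifN // neq_ltn (leq_trans lt_a le_i) orbT.
Qed.

Lemma addr_bounds v : (B <= B + rank v) * (B + rank v < B + n).
Proof. by split; rewrite ?leq_addr ?ltn_add2l. Qed.

(** The 17 units are 3 for finding [z] and [w], 1 for the test, at most 5 for the deletion and 8 for
    the insertion. *)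
Lemma wp_walk_step e X phs cur s k y z :
    sim s X phs cur -> reg s rY = B + rank y -> reg s rZ = B + n + rank z ->
    partner X y = None -> partner M' y = Some z -> e + 17 <= k ->
  wp walk_step (fun s' k' =>
    [/\ same_regs 11 s s',
        sim s' ([set y; z] |: foldl (@apply_op V) X (eviction X z))
          (rcons phs (cur ++ rcons (eviction X z) (Insert y z))) [::],
        reg s' rY = pointer B (partner X z) & e <= k']) s k.
Proof.
case: s => r m ph cu [[/= c0 c1 c2 c6] [km tX tM'] phE cuE pr] yE zE py pz le_k.
have [pr' _ _ _ _] := progress_step adj_sym adj_irr matchM' pr py pz.
have /andP[_ Xt] := prog_match pr; have /andP[_ Xt'] := prog_match pr'.
have := table_move tX Xt Xt'; move: pr' => {Xt'}.
rewrite /eviction; set X' := _ |: _ => pr' tX'.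
have zB : B + n + rank z - n = B + rank z by lia.
apply: wp_seq; apply: wp_block; first by rewrite /=; lia.
rewrite /= zE c1 zB tX; apply: wp_seq; apply: wp_if; first by lia.
case pzX: (partner X z) pr' tX' => [w|] /= pr' tX'; rewrite ?eqn0Ngt ?addn_gt0 ?size_input_gt0 /=.
  apply: wp_block; first by rewrite /=; lia.
  apply: wp_block; first by rewrite /=; lia.
  rewrite /= c2 c6 yE !addKn addn0; split=> //=; last by lia.
    by do 11!case=> //.
  split=> //=.
  - split.
    + by do 3!(apply: input_kept_set; first by rewrite addr_bounds).
    + exact: tX'.
    + by do 3!(apply: table_shift; first by rewrite addr_bounds).
  - by rewrite phE cuE /encode_phases map_rcons map_cat /= -!cats1 -catA.
apply: wp_skip; first by lia.
apply: wp_block; first by rewrite /=; lia.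
rewrite /= c2 c6 yE !addKn addn0; split=> //=; last by lia.
  by do 11!case=> //.
split=> //=.
- split.
  + by do 2!(apply: input_kept_set; first by rewrite addr_bounds).
  + exact: tX'.
  + by do 2!(apply: table_shift; first by rewrite addr_bounds).
- by rewrite phE cuE /encode_phases map_rcons map_cat /= -!cats1.
Qed.

(** [A] collects the exposed vertices left to later walks. The condition on [cur] ensures that an
    open phase is followed by a step that closes it. Each step costs 25: 1 for the loop test, 17 for
    the move, 7 for the next [walk_test]; the 8 pay for the first [walk_test] and the final loop
    test. *)
Lemma wp_walk e (A : {set V}) (y : option V) X phs cur s k :
    sim s X phs cur -> reg s rY = pointer B y ->
    exposed M' X \subset A :|: optset y ->
    cur = [::] \/ (exists2 v, y = Some v & v \in exposed M' X) ->
    e + 8 + 25 * #|M' :\: X| <= k ->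
  wp walk (fun s' k' => exists X' phs',
    [/\ same_regs 11 s s', sim s' X' phs' [::], exposed M' X' \subset A,
        M' :&: X \subset X' /\
        (forall v z, y = Some v -> partner X v = None -> [set v; z] \in M' ->
           [set v; z] \in X')
      & e + 25 * #|M' :\: X'| <= k']) s k.
Proof.
move=> sm yE expA curP le_k; apply: wp_seq.
(* Every step lowers the potential, so induction on it bounds the walk. *)
have [N] := ubnP #|M' :\: X|; elim: N => // N IH in y X phs cur s k sm yE expA curP le_k *.
rewrite ltnS => leN; case: s sm yE => r m ph cu sm yE.
have [[/= c0 c1 c2 c6] [km tX tM'] phE cuE pr] := sm.
apply: wp_block; first by rewrite /=; lia.
set s1 := steps _ _.
have sm1 : sim s1 X phs cur.
  exact: (@Sim s1 X phs cur (And4 c0 c1 c2 c6) (And3 km tX tM') phE cuE pr).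
have ss1 : same_regs 11 (State r m ph cu) s1 by do 11!case=> //.
have m0 : m 0 = n by rewrite km ?size_input_gt0 // inpE.
have testE : (reg s1 rTest != 0) =
    (if y is Some v then (partner X v == None) && (partner M' v != None) else false).
  rewrite /s1 /= c0 c1; move: yE => /= ->; case: (y) => [v|] /=.
    rewrite tX addnAC tM'; have := size_input_gt0.
    by case: (partner X v) => [a|]; case: (partner M' v) => [b|] /=; lia.
  (* For the null pointer, [rW] receives [n] from cell 0; if [n] is zero, [rZ] also reads cell 0 and
     the test fails as well. *)
  by rewrite m0; case: (n) m0 => [->|n1 _]; lia.
move: testE; case: (boolP (reg s1 rTest == 0)) => [/eqP t0 stop|tN0] /=.
  apply: wp_while_false => //=; first by lia.
  have yNexp v : y = Some v -> v \notin exposed M' X.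
    by move=> yv; move: stop; rewrite yv !inE negbK => /esym/negbT.
  (* With an open phase, [y] would be exposed and the test would have succeeded. *)
  have cur0 : cur = [::].
    by case: curP => // -[v /yNexp/negP].
  exists X, phs; split=> //; last by move: (#|_|) le_k => c; lia.
  - by rewrite -cur0.
  - apply/subsetP=> v vX; have := subsetP expA v vX; rewrite inE => /orP[] //.
    by case Ey: y => [u|] /=; rewrite inE // => /eqP ev; have := yNexp u Ey; rewrite -ev vX.
  - split=> [|v z yv pv vzM']; first exact: subsetIr.
    have := yNexp v yv; rewrite !inE pv /= negbK => /eqP.
    by move=> /(partnerNP z); rewrite vzM'.
case Ey: y => [v|] // /esym/andP[/eqP pv]; case Ez: (partner M' v) => [z|] // _.
apply: wp_while_true; rewrite ?tN0 //; first by lia.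
have [_ exp' sub' vzX' ltX'] := progress_step adj_sym adj_irr matchM' pr pv Ez.
set X' := _ |: _ in exp' sub' vzX' ltX'.
apply: wp_seq; apply: wp_conseq (wp_walk_step (e := e + 8 + 25 * #|M' :\: X'|) (k := _) sm1 _ _ pv Ez _).
- rewrite -/X' => s2 k2 [ss2 sm2 y2E le_k2].
  apply: wp_conseq (IH (partner X z) X' _ [::] s2 k2 sm2 y2E _ _ le_k2 _).
  + move=> s2' k2'; apply: wp_conseq => s3 k3 [X3 [phs3 [ss3 sm3 exp3 [sub3 _] le_k3]]]; exists X3, phs3; split=> //.
    * by move=> i lt_i; rewrite ss3 // ss2 // ss1.
    * have subX' : M' :&: X \subset M' :&: X' by rewrite subsetI subsetIl.
      split; first exact: subset_trans subX' sub3.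
      (* The first step inserts the edge of [M'] at the start vertex, and later steps keep it. *)
      move=> u z' [<-] _ vz'; have := partnerE _ vz'; case/andP: matchM' => _ tM'' /(_ tM'').
      by rewrite Ez => -[<-]; apply: (subsetP sub3); rewrite inE vzX' partnerP.
  + apply: subset_trans exp' _; rewrite setSU // subDset setUC.
    by move: expA; rewrite Ey.
  + by left.
  + exact: leq_trans ltX' leN.
- by move: yE; rewrite Ey.
- rewrite /s1 /= c1; move: yE; rewrite Ey /= => ->.
  by rewrite addnAC tM' Ez /=.
- by rewrite /=; move: #|M' :\: X| #|M' :\: X'| le_k ltX' => a b; lia.
Qed.

Lemma wp_walk_from r e (A : {set V}) v X phs cur s k :
    sim s X phs cur -> reg s r = B + rank v -> exposed M' X \subset A :|: [set v] ->
    cur = [::] \/ v \in exposed M' X -> e + 10 + 25 * #|M' :\: X| <= k ->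
  wp (block [:: IAdd rY r rZero]) (wp walk (fun s' k' => exists X' phs',
    [/\ same_regs 11 s s', sim s' X' phs' [::], exposed M' X' \subset A,
        M' :&: X \subset X' /\
        (forall z, partner X v = None -> [set v; z] \in M' -> [set v; z] \in X')
      & e + 25 * #|M' :\: X'| <= k'])) s k.
Proof.
move=> sm rE expA curP le_k.
have [[_ _ _ c6] tab phE cuE pr] := sm.
apply: wp_block; first by apply: leq_trans le_k; rewrite /=; lia.
case: s sm rE c6 tab phE cuE => r0 m ph cu sm rE c6 tab phE cuE.
set s1 := steps _ _.
have sm1 : sim s1 X phs cur by have [[? ? ? ?]] := sm.
have yE : reg s1 rY = pointer B (Some v) by rewrite /s1 /= in rE c6 *; rewrite rE c6 addn0.
apply: wp_conseq (wp_walk (e := e) (k := _) sm1 yE expA _ _).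
- move=> s' k' [X' [phs' [ss' sm' exp' [sub' vX'] le_k']]]; exists X', phs'; split=> //.
    by move=> i lt_i; rewrite ss' //; move: i lt_i; do 11!case=> //.
  by split=> // z; apply: vX'.
- by case: curP => [->|vX]; [left|right; exists v].
- by rewrite /=; move: #|_| le_k => a; lia.
Qed.

(** * The two passes over the target edges *)

Lemma potential_le X X' : M' :&: X \subset X' -> #|M' :\: X'| <= #|M' :\: X|.
Proof.
move=> /subsetP sub; apply/subset_leq_card/subsetP=> A; rewrite !inE => /andP[AX' AM'].
by rewrite AM' andbT; apply: contra AX' => AX; apply: sub; rewrite inE AM'.
Qed.

Lemma target_edge v : v \in covered M' ->
  exists2 f, f \in L' & v \in [set f.1; f.2].
Proof.
rewrite inE; case Ev: (partner M' v) => [z|] // _; have := partnerP Ev.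
by rewrite (proj2 listL') => /mapP[f fL' fE]; exists f; rewrite // -fE set21.
Qed.

(** Exposed vertices are always endpoints of edges of [L'] not yet visited, and the walks from both
    ends of an edge remove them. An edge costs 30: 10 for the loop and 10 of overhead for each walk;
    the potential pays for the steps. *)
Lemma wp_fill_gaps e s k :
    sim s M [::] [::] -> aimed s B L' -> e + 3 + 30 * size L' + 25 * #|M'| <= k ->
  wp (for_edges fill_gaps) (fun s' k' => exists X phs,
    [/\ sim s' X phs [::], exposed M' X = set0 & e + 25 * #|M' :\: X| <= k']) s k.
Proof.
move=> [cs tab phE cuE pr] aim le_k.
pose E (ls : seq (V * V)) := [set v | has (fun f => v \in [set f.1; f.2]) ls].
pose J (ls : seq (V * V)) m ph (cu : seq (op nat)) k := exists X phs, [/\ tables m X M',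
  ph = encode_phases phs, cu = [::], progress adj M M' phs [::] X
  & exposed M' X \subset E ls /\ e.+1 + 30 * size ls + 25 * #|M' :\: X| <= k].
apply: (wp_for_edges (b := B) (J := J) (ls := L')) => //.
- by move=> ls m ph cu k1 [X [phs [[]]]].
- move=> f ls s1 k1 cs1 [X [phs [tab1 phE1 cuE1 pr1 [exp1 le_k1]]]] uE vE.
  move aE: #|M' :\: X| le_k1 => a le_k1; rewrite /= in le_k1.
  split; first by lia.
  have sm1 : sim s1 X phs [::] by [].
  apply: wp_seq; apply: wp_conseq (wp_walk_from (r := rU)
    (e := e + 13 + 30 * size ls) (A := E ls :|: [set f.2]) sm1 uE _ _ _).
  + move=> s2 k2 run; apply: wp_seq; apply: wp_conseq run.
    move=> s3 k3 [X3 [phs3 [s13 sm3 exp3 _ le_k3]]].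
    move a3E: #|M' :\: X3| le_k3 => a3 le_k3.
    apply: wp_seq; apply: wp_conseq (wp_walk_from (r := rV)
      (e := e + 3 + 30 * size ls) (A := E ls) (v := f.2) sm3 _ exp3 _ _) => //.
    * move=> s4 k4; apply: wp_conseq => s5 k5 [X5 [phs5 [s35 [cs5 tab5 phE5 cuE5 pr5] exp5 _ le_k5]]].
      move a5E: #|M' :\: X5| le_k5 => a5 le_k5; split; [|lia|].
        by move=> i lt_i; rewrite s35 ?s13 //; apply: leq_trans lt_i _.
      by exists X5, phs5; split=> //; split=> //; rewrite a5E; lia.
    * by rewrite s13.
    * by left.
    * by rewrite a3E; lia.
  + apply: subset_trans exp1 _; apply/subsetP=> v; rewrite !inE /= !inE.
    by case: (v == f.1); case: (v == f.2); rewrite ?orbT ?orbF.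
  + by left.
  + by rewrite aE; lia.
- by move: #|M'| le_k => a; lia.
- exists M, [::]; split=> //; split.
    apply/subsetP=> v; rewrite !inE => /andP[_ vM'].
    have [|f fL' vf] := @target_edge v; first by rewrite inE.
    by apply/hasP; exists f.
  (* Comparison with the empty set bounds the initial potential by [#|M'|]. *)
  have := potential_le (X := set0) (X' := M); rewrite setI0 sub0set setD0 => /(_ isT).
  by move: #|_| #|_| le_k => a b; lia.
- move=> s2 k2 cs2 [X [phs [tab2 phE2 cuE2 pr2 [exp2 le_k2]]]].
  move aE: #|M' :\: X| le_k2 => a le_k2; split; first by lia.
  exists X, phs; split=> //; last by rewrite aE; lia.
  apply/eqP; rewrite -subset0; apply: subset_trans exp2 _.
  by apply/subsetP=> v; rewrite inE.
Qed.

(** No vertex is exposed between iterations, so each may delete an edge, and a visited edge of [M']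
    stays in [X]. An edge costs at most 41: 10 for the loop, 6 for the comparison, 7 for the
    deletion, 8 and 10 of overhead for the walks. *)
Lemma wp_break_cycle e X0 phs0 s k :
    sim s X0 phs0 [::] -> exposed M' X0 = set0 -> aimed s B L' ->
    e + 3 + 41 * size L' + 25 * #|M' :\: X0| <= k ->
  wp (for_edges break_cycle) (fun s' k' => exists X phs,
    [/\ sim s' X phs [::], M' \subset X & e <= k']) s k.
Proof.
move=> [cs tab phE cuE pr] exp0 aim le_k.
pose J (ls : seq (V * V)) m ph (cu : seq (op nat)) k := exists X phs, [/\ tables m X M',
  ph = encode_phases phs, cu = [::], progress adj M M' phs [::] X
  & [/\ exposed M' X = set0, {subset ls <= L'},
        (forall f : V * V, f \in L' -> f \in ls \/ [set f.1; f.2] \in X)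
      & e.+1 + 41 * size ls + 25 * #|M' :\: X| <= k]].
apply: (wp_for_edges (b := B) (J := J) (ls := L')) => //.
- by move=> ls m ph cu k1 [X [phs [[]]]].
- move=> [u v] ls s1 k1 cs1 [X [phs [tab1 phE1 cuE1 pr1 [exp1 sub1 done1 le_k1]]]] uE vE.
  move aE: #|M' :\: X| le_k1 => a le_k1; rewrite /= in le_k1 uE vE.
  split; first by lia.
  have uvM' : [set u; v] \in M'.
    rewrite (proj2 listL'); apply/mapP; exists (u, v) => //.
    by apply: sub1; rewrite inE eqxx.
  have /andP[M'e M't] := matchM'.
  have pu' : partner M' u = Some v := partnerE M't uvM'.
  (* [M'] covers [u] and nothing is exposed, so [u] has a current mate. *)
  have [x pu] : exists x, partner X u = Some x.
    case pu: (partner X u) => [x|]; first by exists x.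
    by move/setP/(_ u): exp1; rewrite !inE pu pu'.
  have subls : {subset ls <= L'} by move=> f fls; apply: sub1; rewrite inE fls orbT.
  have advance X' : M' :&: X \subset X' -> [set u; v] \in X' ->
      forall f : V * V, f \in L' -> f \in ls \/ [set f.1; f.2] \in X'.
    move=> /subsetP sub uvX' f fL'; case: (done1 f fL') => [|fX].
      by rewrite inE => /orP[/eqP->|]; [right|left].
    right; apply: sub; rewrite inE fX andbT (proj2 listL'); apply/mapP.
    by exists f.
  case: s1 cs1 tab1 phE1 cuE1 uE vE => r m ph cu cs1 tab1 phE1 cuE1 uE vE.
  have [km tX tM'] := tab1; have [/= c0 c1 c2 c6] := cs1; rewrite /= in phE1 cuE1 uE vE km tX tM'.
  apply: wp_seq; apply: wp_block; first by rewrite /=; lia.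
  apply: wp_if => /=; first by lia.
  rewrite uE vE tX pu /=.
  have [xv|xNv] := eqVneq x v.
    subst x; rewrite subnn addn0 /=; apply: wp_skip; first by lia.
    split; [by do 7!case=> //|by lia|].
    exists X, phs; split=> //; split=> //; last by rewrite aE; lia.
    by apply: advance; rewrite ?subsetIr ?partnerP.
  rewrite ifT; last by have := rank_eq x v; rewrite (negPf xNv) => /negbT; rewrite addn_eq0 !subn_eq0 !leq_add2l -eqn_leq.
  have uxM' : [set u; x] \notin M'.
    by apply: contra xNv => uxM'; have := partnerE M't uxM'; rewrite pu' => -[->].
  have [pr2 exp2 pu2 sub2] := progress_break adj_irr matchM' pr1 exp1 pu uxM'.
  set X2 := X :\ _ in pr2 exp2 pu2 sub2.
  have a2E := potential_le sub2; rewrite aE in a2E.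
  apply: wp_seq; apply: wp_block; first by rewrite /=; lia.
  set s2 := steps _ _; set k2 := _ - _.
  have /andP[_ Xt] := prog_match pr1.
  have sm2 : sim s2 X2 phs [:: Delete u x].
    split=> //; last by rewrite /s2 /= cuE1 uE c2 !addKn.
    rewrite /s2 /= uE c6; split.
    - by do 2!(apply: input_kept_set; first by rewrite addr_bounds).
    - exact: table_del tX Xt (partnerP pu).
    - by do 2!(apply: table_shift; first by rewrite addr_bounds).
  have y2E : reg s2 rY = pointer B (Some u) by rewrite /s2 /= uE c6 addn0.
  have x2E : reg s2 rX = B + rank x by [].
  have s12 : same_regs 7 (State r m ph cu) s2 by do 7!case=> //.
  have le_k2 : e + 21 + 41 * size ls + 25 * a <= k2 by rewrite /k2 /=; lia.
  clearbody s2 k2.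
  apply: wp_seq; apply: wp_conseq (wp_walk (e := e + 13 + 41 * size ls)
    (A := [set x]) sm2 y2E _ _ _).
  + move=> s3 k3 [X3 [phs3 [s23 sm3 exp3 [sub3 u3] le_k3]]].
    (* The walk started at [u], just freed, so its first step inserted [uv]. *)
    have uvX3 := u3 u v erefl pu2 uvM'.
    move a3E: #|M' :\: X3| le_k3 => a3 le_k3.
    (* The walk from [x] leaves nothing exposed, which restores the invariant. *)
    apply: wp_seq; apply: wp_conseq (wp_walk_from (r := rX) (v := x)
      (e := e + 3 + 41 * size ls) (A := set0) sm3 _ _ _ _).
    * move=> s4 k4; apply: wp_conseq => s5 k5 [X5 [phs5 [s35 [cs5 tab5 phE5 cuE5 pr5] exp5 [sub5 _] le_k5]]].
      move a5E: #|M' :\: X5| le_k5 => a5 le_k5; split; [|by clear -le_k5; lia|].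
        by move=> i lt_i; rewrite s35 ?s23 ?s12 //; apply: leq_trans lt_i _.
      exists X5, phs5; split=> //; split=> //; last by rewrite a5E; clear -le_k5; lia.
        by apply/eqP; rewrite -subset0.
      apply: advance; last by apply: (subsetP sub5); rewrite inE uvM'.
      have sub2' : M' :&: X \subset M' :&: X2 by rewrite subsetI subsetIl.
      have sub3' : M' :&: X2 \subset M' :&: X3 by rewrite subsetI subsetIl.
      exact: subset_trans (subset_trans sub2' sub3') sub5.
    * by rewrite s23.
    * by rewrite set0U.
    * by left.
    * by rewrite a3E; clear -le_k3; lia.
  + by rewrite /= setUC.
  + by right; exists u => //; rewrite !inE pu2 pu'.
  + by move: #|_| a2E => b; clear -le_k2; lia.
- by move: #|_| le_k => a; lia.
- exists X0, phs0; split=> //; split=> //; last by move: #|_| le_k => a; lia.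
  by left.
- move=> s2 k2 cs2 [X [phs [tab2 phE2 cuE2 pr2 [_ _ done2 le_k2]]]].
  split; first by apply: leq_trans le_k2.
  exists X, phs; split=> //; last by move: #|_| le_k2 => a; lia.
  apply/subsetP=> A; rewrite (proj2 listL') => /mapP[f fL' ->].
  by case: (done2 f fL').
Qed.

(** * Loading the mate tables and running the whole program *)

Lemma wp_load e Z (b : nat) (ls : seq (V * V)) s k :
    is_matching adj Z -> edge_list Z ls -> consts (reg s) -> aimed s b ls ->
    B <= b -> input_kept (cells s) -> (forall a, b <= a -> cells s a = 0) ->
    closed_phases s = [::] -> open_phase s = [::] -> e + 3 + 13 * size ls <= k ->
  wp (for_edges store_edge) (fun s' k' =>
    [/\ consts (reg s'), input_kept (cells s'), table (cells s') b Z,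
        (forall a, ~~ (b <= a < b + n) -> cells s' a = cells s a)
      & [/\ closed_phases s' = [::], open_phase s' = [::] & e <= k']]) s k.
Proof.
move=> mZ [_ listZ] cs aim le_B km m0 phE cuE le_k.
have /andP[_ Zt] := mZ.
(* [X] is the part of [Z] stored so far. An edge costs 13: 10 for the loop and 3 for the two
   stores. *)
pose J (ls : seq (V * V)) m (ph : seq (seq (op nat))) (cu : seq (op nat)) k :=
  exists X, [/\ X \subset Z, table m b X,
    (forall A, A \in Z -> A \in X \/ A \in [seq [set f.1; f.2] | f <- ls]),
    (forall a, ~~ (b <= a < b + n) -> m a = cells s a)
  & [/\ {subset [seq [set f.1; f.2] | f <- ls] <= Z}, ph = [::], cu = [::]
      & e.+1 + 13 * size ls <= k]].
have kept m : (forall a, ~~ (b <= a < b + n) -> m a = cells s a) -> input_kept m.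
  by move=> mE i lt_i; rewrite mE ?km // negb_and -ltnNge (leq_trans lt_i le_B).
apply: (wp_for_edges (b := b) (J := J) (ls := ls)) => //.
- by move=> ls1 m ph cu k1 [X [_ _ _ /kept]].
- move=> [u v] ls1 [r m ph cu] k1 cs1 /= [X [sub tX todo mE [subls -> -> le_k1]]] uE vE.
  rewrite /= in le_k1; split; first by lia.
  rewrite /store_edge; apply: wp_block; first by rewrite /=; lia.
  split; [by do 7!case=> //|by rewrite /=; lia|].
  have uvZ : [set u; v] \in Z by apply: subls; rewrite inE eqxx.
  have subX' : [set u; v] |: X \subset Z by rewrite subUset sub1set uvZ.
  exists ([set u; v] |: X); rewrite /= uE vE; split=> //.
  + exact: table_add (trivIsetS subX' Zt).
  + move=> A /todo[AX|]; first by left; rewrite inE AX orbT.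
    by rewrite inE => /orP[/eqP->|]; [left; rewrite setU11|right].
  + move=> a aNb; rewrite !ifN ?mE //; apply: contra aNb => /eqP->;
    by rewrite leq_addr ltn_add2l ltn_ord.
  + split=> //; last by lia.
    by move=> A Als; apply: subls; rewrite inE Als orbT.
- by lia.
- exists set0; split=> //.
  + by rewrite sub0set.
  + by move=> v; rewrite m0 ?leq_addr // partner0.
  + by move=> A; rewrite -listZ => AZ; right.
  + by split=> //; [move=> A; rewrite -listZ|lia].
- move=> s' k' cs' [X [sub tX todo mE [_ phE' cuE' le_k']]].
  split; first by apply: leq_trans le_k'.
  have XZ : X = Z.
    by apply/eqP; rewrite eqEsubset sub; apply/subsetP=> A /todo[].
  by split=> //; [exact: kept|rewrite -XZ|split=> //; lia].
Qed.

Lemma input_source j : j < size L * 2 -> nth 0 inp (3 + j) = nth 0 (edge_words L) j.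
Proof. by move=> lt_j; rewrite inpE /input /= add0n nth_cat size_edge_words lt_j. Qed.

Lemma input_target j : nth 0 inp (3 + size L * 2 + j) = nth 0 (edge_words L') j.
Proof. by rewrite inpE /input -addnA /= add0n nth_cat size_edge_words ltnNge leq_addr addKn. Qed.

Lemma target_edgesP r s : r \in [:: rN; rZero] -> consts (reg s) -> input_kept (cells s) ->
  [/\ consts (reg (steps (target_edges r) s)),
      aimed (steps (target_edges r) s) (B + reg s r) L',
      cells (steps (target_edges r) s) = cells s,
      closed_phases (steps (target_edges r) s) = closed_phases s
    & open_phase (steps (target_edges r) s) = open_phase s].
Proof.
case: s => rg m ph cu rP [/= c0 c1 c2 c6] km.
have m1 : m 1 = size L by rewrite km ?inpE // size_input.
move: rP; rewrite !inE => /orP[]/eqP->; split=> //.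
all: rewrite /aimed /= c0 m1 c2 c6 addn0; split=> //; first by rewrite size_input; lia.
all: move=> j lt_j; rewrite -input_target; congr (nth 0 inp (_ + _)); lia.
Qed.

Lemma wp_transform :
  wp transform (fun s _ => exists X phs, sim s X phs [::] /\ M' \subset X)
    (init_state inp) (150 * (size L + size L' + 1)).
Proof.
have sizeM' : #|M'| = size L' := esym (proj1 listL').
have B3 : 3 <= B by rewrite size_input; lia.
apply: wp_seq; apply: wp_block; first by rewrite /=; lia.
set s1 := steps _ _; set k1 := _ - _.
(* The eleven instructions of [setup] cost 12. The constant 150 is generous: a source edge needs 13
   units, and a target edge 13 + 30 + 41 for the passes and 25 of potential. *)
have le_k1 : 138 + 13 * size L + 150 * size L' <= k1 by rewrite /k1 /=; lia.
have BE' : B = size L + size L + 3 + (size L' + size L') by rewrite size_input; lia.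
have [inp0 inp1 inp2] : [/\ nth 0 inp 0 = n, nth 0 inp 1 = size L & nth 0 inp 2 = size L'].
  by rewrite inpE.
have cs1 : consts (reg s1) by split; rewrite // /s1 /= inp1 inp2.
have aim1 : aimed s1 B L.
  rewrite /aimed /s1 /= inp1 inp2 -BE' addn0; split=> //; [lia|lia|].
  exact: input_source.
have high a : B <= a -> cells s1 a = 0 by move=> le_a; apply: nth_default; rewrite -BE.
apply: wp_seq; apply: wp_conseq (wp_load (e := 100 + 150 * size L') matchM listL cs1 aim1
  (leqnn _) _ high erefl erefl _) => //; last by clear -le_k1; lia.
clearbody k1; move=> s2 k2 [cs2 km2 tM2 mE2 [ph2 cu2 le_k2]].
have [cs3 aim3 mE3 phE3 cuE3] := target_edgesP (r := rN) isT cs2 km2.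
apply: wp_seq; apply: wp_block; first by rewrite /=; lia.
set s3 := steps _ s2 in cs3 aim3 mE3 phE3 cuE3 *; clearbody s3.
have regN : reg s2 rN = n by have [] := cs2.
rewrite regN in aim3.
apply: wp_seq; apply: wp_conseq (wp_load (e := 60 + 130 * size L') matchM' listL' cs3 aim3
  _ _ _ _ _ _); rewrite ?mE3 ?phE3 ?cuE3 ?leq_addr //; [|move=> a le_a|by rewrite /=; lia]; last first.
  rewrite mE2 ?high //; first exact: leq_trans (leq_addr _ _) le_a.
  by rewrite negb_and -leqNgt le_a orbT.
move=> s4 k4 [cs4 km4 tM4 mE4 [ph4 cu4 le_k4]].
have sm4 : sim s4 M [::] [::].
  split=> //; last exact: progress_start.
  (* Loading the table of [M'] leaves the cells below [B + n] unchanged. *)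
  split=> //; apply: (table_other _ tM2) => a /andP[_ lt_a].
  by rewrite mE4 ?mE3 // negb_and -ltnNge lt_a.
have [cs5 aim5 mE5 phE5 cuE5] := target_edgesP (r := rZero) isT cs4 km4.
apply: wp_seq; apply: wp_block; first by rewrite /=; lia.
set s5 := steps _ s4 in cs5 aim5 mE5 phE5 cuE5 *; clearbody s5.
have reg0 : reg s4 rZero = 0 by have [] := cs4.
rewrite reg0 addn0 in aim5.
have sm5 : sim s5 M [::] [::].
  by have [_ tab phE cuE pr] := sm4; split; rewrite ?mE5 ?phE5 ?cuE5.
apply: wp_seq; apply: wp_conseq (wp_fill_gaps (e := 10 + 41 * size L') sm5 aim5 _); last first.
  by rewrite sizeM' /=; lia.
move=> s6 k6 [X6 [phs6 [sm6 exp6 le_k6]]].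
have [cs6 [km6 _ _] phE6 cuE6 pr6] := sm6.
have [cs7 aim7 mE7 phE7 cuE7] := target_edgesP (r := rZero) isT cs6 km6.
apply: wp_seq; apply: wp_block; first by rewrite /=; move: #|_| le_k6 => a le_k6; lia.
set s7 := steps _ s6 in cs7 aim7 mE7 phE7 cuE7 *; clearbody s7.
have reg6 : reg s6 rZero = 0 by have [] := cs6.
rewrite reg6 addn0 in aim7.
have sm7 : sim s7 X6 phs6 [::].
  by have [_ tab phE cuE pr] := sm6; split; rewrite ?mE7 ?phE7 ?cuE7.
apply: wp_conseq (wp_break_cycle (e := 0) sm7 exp6 aim7 _); last first.
  by rewrite /=; move: #|_| le_k6 => a le_k6; lia.
by move=> s8 k8 [X8 [phs8 [sm8 sub8 _]]]; exists X8, phs8.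
Qed.

End Run.

Theorem theorem1 :
  exists (P : program) (c : nat),
  forall (V : finType) (adj : rel V),
    symmetric adj -> irreflexive adj ->
  forall M M' : {set {set V}},
    is_matching adj M -> is_matching adj M' ->
  forall L L' : seq (V * V),
    edge_list M L -> edge_list M' L' ->
  exists (phases : seq (seq (op V))) (t : nat),
    [/\ gradual_transformation adj M M' phases,
        all (fun phase => size phase <= 3) phases,
        forall i, i < size phases ->
          is_matching adj (after M phases i.+1) /\
          minn #|M| (#|M'| - 1) <= #|after M phases i.+1|,
        outputs P (input L L') (encode_phases phases) t
      & t <= c * (#|M| + #|M'| + 1)].
Proof.
exists transform, 150 => V adj adj_sym adj_irr M M' matchM matchM' L L' listL listL'.
have [t [s [run le_t [X [phs [[_ _ phE cuE [[le3 val] leg XE _ _ _ _]] sub]]]]]] :=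
  wp_transform adj_sym adj_irr matchM matchM' listL listL' erefl erefl.
(* No operation is left in an open phase, so the closed phases form the whole sequence. *)
rewrite !cats0 in leg XE.
exists phs, t; split=> //; last by rewrite -(proj1 listL) -(proj1 listL').
- split=> //; first by rewrite after_size -XE.
  by move=> i /val[].
- by move=> i /val[].
- by exists s.
Qed.
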